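(* Let $\mathcal{F}$ be a finite field and let $p\in[0,1]$. Consider random linear network coding over $\mathcal{F}$ with information rate $2$ for the butterfly network $G$ with channel failure probability $p$ (each of the nine channels is deleted with probability $p$, independently of each other and of the local encoding coefficients, which are independent and uniformly distributed on $\mathcal{F}$). Then: (i) for $i=1,2$, the failure probability of the sink node $t_i$ is $$\tilde P_e(t_i)=1-\frac{(|\mathcal{F}|+1)(|\mathcal{F}|-1)^6}{|\mathcal{F}|^7}(1-p)^6;$$ (ii) the failure probability of the butterfly network $G$ is $$\tilde P_e=1-\frac{(|\mathcal{F}|+1)(|\mathcal{F}|-1)^{10}}{|\mathcal{F}|^{11}}(1-p)^9;$$ (iii) the average failure probability is $$\tilde P_{av}=1-\frac{(|\mathcal{F}|+1)(|\mathcal{F}|-1)^6}{|\mathcal{F}|^7}(1-p)^6.$$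
   Context: Butterfly network. $G=(V,E)$ is the directed acyclic graph with nodes $s$ (source), $s_1,s_2,i,j$ (internal nodes), $t_1,t_2$ (sinks, $T=\{t_1,t_2\}$) and channels (edges) $e_1=(s,s_1)$, $e_2=(s,s_2)$, $e_3=(s_1,t_1)$, $e_4=(s_1,i)$, $e_5=(s_2,i)$, $e_6=(s_2,t_2)$, $e_7=(i,j)$, $e_8=(j,t_1)$, $e_9=(j,t_2)$. In addition, the source $s$ has two imaginary incoming channels $d_1,d_2$ carrying the two source messages; these are not subject to failure. Random linear network coding with information rate $2$. The local encoding coefficients are the twelve random variables $k_{d_1,1},k_{d_2,1},k_{d_1,2},k_{d_2,2},k_{1,3},k_{1,4},k_{2,5},k_{2,6},k_{4,7},k_{5,7},k_{7,8},k_{7,9}$, which are independent and uniformly distributed on the finite field $\mathcal{F}$. Channel failures. For each $m\in\{1,\dots,9\}$ the channel $e_m$ is deleted from the network with probability $p$, and is called successful if it is not deleted; the nine deletion events are mutually independent and independent of all local encoding coefficients. The kernels $f_m$ and the active global encoding kernels $\tilde f_m$ are column vectors in $\mathcal{F}^2$ defined recursively as follows: $\tilde f_m=f_m$ if $e_m$ is successful and $\tilde f_m=\underline{0}$ (the zero vector) otherwise, where, with $f_{d_1}=\binom{1}{0}$ and $f_{d_2}=\binom{0}{1}$, $$f_1=k_{d_1,1}f_{d_1}+k_{d_2,1}f_{d_2},\quad f_2=k_{d_1,2}f_{d_1}+k_{d_2,2}f_{d_2},$$ $$f_3=k_{1,3}\tilde f_1,\quad f_4=k_{1,4}\tilde f_1,\quad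 f_5=k_{2,5}\tilde f_2,\quad f_6=k_{2,6}\tilde f_2,$$ $$f_7=k_{4,7}\tilde f_4+k_{5,7}\tilde f_5,\quad f_8=k_{7,8}\tilde f_7,\quad f_9=k_{7,9}\tilde f_7.$$ The decoding matrices of the sinks are the $2\times 2$ matrices $F_{t_1}=(\tilde f_3\ \tilde f_8)$ and $F_{t_2}=(\tilde f_6\ \tilde f_9)$. Failure probabilities. $\tilde P_e(t_i)=\Pr(\mathrm{Rank}(F_{t_i})<2)$ for $i=1,2$; $\tilde P_e=\Pr(\exists\, t\in T \text{ such that } \mathrm{Rank}(F_t)<2)$; $\tilde P_{av}=\frac{1}{|T|}\sum_{t\in T}\tilde P_e(t)=\frac{\tilde P_e(t_1)+\tilde P_e(t_2)}{2}$. *)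

(* Defs.v *)
From HB Require Import structures.
From mathcomp Require Import all_boot all_order all_algebra.
From mathcomp Require Import all_classical all_reals all_analysis.

Set Implicit Arguments.
Unset Strict Implicit.
Unset Printing Implicit Defensive.

Import Order.TTheory GRing.Theory Num.Theory.

Local Open Scope classical_set_scope.
Local Open Scope ring_scope.

(* The channels of the butterfly network, whose nodes are the source s, the
   internal nodes s1, s2, i, j and the sinks t1, t2. *)
Inductive channel : Type :=
| e1  (* s  -> s1 *)
| e2  (* s  -> s2 *)
| e3  (* s1 -> t1 *)
| e4  (* s1 -> i  *)
| e5  (* s2 -> i  *)
| e6  (* s2 -> t2 *)
| e7  (* i  -> j  *)
| e8  (* j  -> t1 *)
| e9. (* j  -> t2 *)

(* k_a_b indexes the local encoding coefficient from the channel e_a (or the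
   imaginary source channel a = d1, d2) to the adjacent channel e_b. *)
Inductive coef : Type :=
| k_d1_1 | k_d2_1 | k_d1_2 | k_d2_2
| k_1_3 | k_1_4 | k_2_5 | k_2_6
| k_4_7 | k_5_7 | k_7_8 | k_7_9.

Inductive sink : Type := t1 | t2.

Definition channel_enum : seq channel := [:: e1; e2; e3; e4; e5; e6; e7; e8; e9].

Definition channel_code (m : channel) : nat :=
  (match m with
  | e1 => 0 | e2 => 1 | e3 => 2 | e4 => 3 | e5 => 4
  | e6 => 5 | e7 => 6 | e8 => 7 | e9 => 8
  end)%N.

Lemma channel_codeK : pcancel channel_code (onth channel_enum).
Proof. by case. Qed.

HB.instance Definition _ := Countable.copy channel (pcan_type channel_codeK).

Lemma channel_enumP : Finite.axiom channel_enum.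
Proof. by case. Qed.

HB.instance Definition _ :=
  fintype.isFinite.Build channel channel_enumP.

Definition coef_enum : seq coef :=
  [:: k_d1_1; k_d2_1; k_d1_2; k_d2_2; k_1_3; k_1_4; k_2_5; k_2_6;
      k_4_7; k_5_7; k_7_8; k_7_9].

Definition coef_code (c : coef) : nat :=
  (match c with
  | k_d1_1 => 0 | k_d2_1 => 1 | k_d1_2 => 2 | k_d2_2 => 3
  | k_1_3 => 4 | k_1_4 => 5 | k_2_5 => 6 | k_2_6 => 7
  | k_4_7 => 8 | k_5_7 => 9 | k_7_8 => 10 | k_7_9 => 11
  end)%N.

Lemma coef_codeK : pcancel coef_code (onth coef_enum).
Proof. by case. Qed.

HB.instance Definition _ := Countable.copy coef (pcan_type coef_codeK).

Lemma coef_enumP : Finite.axiom coef_enum.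
Proof. by case. Qed.

HB.instance Definition _ :=
  fintype.isFinite.Build coef coef_enumP.

Definition sink_enum : seq sink := [:: t1; t2].

Definition sink_code (t : sink) : nat :=
  (match t with t1 => 0 | t2 => 1 end)%N.

Lemma sink_codeK : pcancel sink_code (onth sink_enum).
Proof. by case. Qed.

HB.instance Definition _ := Countable.copy sink (pcan_type sink_codeK).

Lemma sink_enumP : Finite.axiom sink_enum.
Proof. by case. Qed.

HB.instance Definition _ :=
  fintype.isFinite.Build sink sink_enumP.

(* The kernels for given values [k] of the local encoding coefficients and a
   given deletion pattern: [del m] means that the channel m is deleted. *)
Definition encoding_kernel (F : finFieldType) (k : coef -> F) (del : channel -> bool)
    (m : channel) : 'cV[F]_2 :=
  let act m' (f : 'cV[F]_2) := if del m' then 0 else f in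
  let fd1 : 'cV[F]_2 := delta_mx 0 0 in
  let fd2 : 'cV[F]_2 := delta_mx 1 0 in
  let f1 := k k_d1_1 *: fd1 + k k_d2_1 *: fd2 in
  let f2 := k k_d1_2 *: fd1 + k k_d2_2 *: fd2 in
  let f3 := k k_1_3 *: act e1 f1 in
  let f4 := k k_1_4 *: act e1 f1 in
  let f5 := k k_2_5 *: act e2 f2 in
  let f6 := k k_2_6 *: act e2 f2 in
  let f7 := k k_4_7 *: act e4 f4 + k k_5_7 *: act e5 f5 in
  let f8 := k k_7_8 *: act e7 f7 in
  let f9 := k k_7_9 *: act e7 f7 in
  match m with
  | e1 => f1 | e2 => f2 | e3 => f3 | e4 => f4 | e5 => f5
  | e6 => f6 | e7 => f7 | e8 => f8 | e9 => f9
  end.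

Definition active_kernel (F : finFieldType) (k : coef -> F)
    (del : channel -> bool) (m : channel) : 'cV[F]_2 :=
  if del m then 0 else encoding_kernel k del m.

Definition decoding_matrix (F : finFieldType) (k : coef -> F)
    (del : channel -> bool) (t : sink) : 'M[F]_2 :=
  match t with
  | t1 => row_mx (active_kernel k del e3) (active_kernel k del e8)
  | t2 => row_mx (active_kernel k del e6) (active_kernel k del e9)
  end.

(* Random variables with values in a finite set V (discrete sigma-algebra). *)
Definition finite_rv d (T : measurableType d) (V : finType) (X : T -> V) :=
  forall a : V, measurable (X @^-1` [set a]).

Definition rv_events (T : Type) (V : Type) (X : T -> V) : set (set T) :=
  [set X @^-1` A | A in [set: set V]].

Definition mutually_independent d (T : measurableType d) (R : realType)
    (P : probability T R) (I : finType) (G : I -> set (set T)) :=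
  forall (J : {set I}) (E : I -> set T),
    (forall i, i \in J -> G i (E i)) ->
    P (\bigcap_(i in [set` J]) E i) = (\prod_(i in J) P (E i))%E.

(* Random linear network coding over F on the butterfly network with channel
   failure probability p: [k c] is the random coefficient c, and [del m] is the
   indicator of the event that the channel m is deleted. *)
Record butterfly_rlnc d (T : measurableType d) (R : realType)
    (P : probability T R) (F : finFieldType) (p : R)
    (k : coef -> T -> F) (del : channel -> T -> bool) : Prop := ButterflyRlnc {
  coef_rv : forall c, finite_rv (k c);
  del_rv : forall m, finite_rv (del m);
  coef_uniform : forall c a, P (k c @^-1` [set a]) = (#|F|%:R^-1)%:E;
  del_prob : forall m, P [set w | del m w] = p%:E;
  coef_del_independent : mutually_independent P
    (fun x : coef + channel =>
       match x with
       | inl c => rv_events (k c)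
       | inr m => rv_events (del m)
       end)
}.

Definition sink_failure (T : Type) (F : finFieldType) (k : coef -> T -> F)
    (del : channel -> T -> bool) (t : sink) : set T :=
  [set w | (\rank (decoding_matrix (k^~ w) (del^~ w) t) < 2)%N].

Definition sink_failure_prob d (T : measurableType d) (R : realType)
    (P : probability T R) (F : finFieldType) (k : coef -> T -> F)
    (del : channel -> T -> bool) (t : sink) : \bar R :=
  P (sink_failure k del t).

Definition network_failure_prob d (T : measurableType d) (R : realType)
    (P : probability T R) (F : finFieldType) (k : coef -> T -> F)
    (del : channel -> T -> bool) : \bar R :=
  P [set w | exists t : sink, sink_failure k del t w].

Definition average_failure_prob d (T : measurableType d) (R : realType)
    (P : probability T R) (F : finFieldType) (k : coef -> T -> F)
    (del : channel -> T -> bool) : \bar R :=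
  ((#|{: sink}|%:R^-1)%:E * \sum_(t : sink) sink_failure_prob P k del t)%E.

(* Main.v *)
(* The determinant of the decoding matrix of a sink is, up to sign, the product
   of the determinant of (f_1 f_2), of four local coefficients and of the
   success indicators of six channels. Hence decoding succeeds exactly when
   (f_1 f_2) is invertible, these coefficients are nonzero and these channels
   are not deleted; for both sinks together this involves eight coefficients
   and all nine channels. Conditioning on the value of (f_1 f_2) in GL_2(F),
   each value contributes a product of independent events, and
   |GL_2(F)| = q (q - 1)^2 (q + 1). *)
Require Import Defs.
From HB Require Import structures.
From mathcomp Require Import all_boot all_order all_algebra.
From mathcomp Require Import ring.
From mathcomp Require Import all_classical all_reals all_analysis.

Import Order.TTheory GRing.Theory Num.Theory.

Local Open Scope classical_set_scope.
Local Open Scope ring_scope.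

(** * Determinants, rank and finite additivity *)

Lemma det_mx2 (A : comNzRingType) (M : 'M[A]_2) :
  \det M = M 0 0 * M 1 1 - M 0 1 * M 1 0.
Proof.
rewrite (expand_det_row _ ord0) !big_ord_recl big_ord0 addr0 /cofactor.
rewrite !det_mx11 !mxE /= expr0 expr1 mul1r mulN1r mulrN.
by congr (M _ _ * M _ _ - M _ _ * M _ _); apply/val_inj.
Qed.

Lemma rank_lt_det (K : fieldType) n (M : 'M[K]_n) :
  (\rank M < n)%N = (\det M == 0).
Proof.
by rewrite ltn_neqAle rank_leq_row andbT -[_ == n]/(row_free M) row_free_unit
  unitmxE unitfE negbK.
Qed.

Lemma probability_finite_union {d} {T : measurableType d} {R : realType}
    (P : probability T R) (V : finType) (E : V -> set T) :
  (forall v, measurable (E v)) -> trivIset setT E ->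
  P (\bigcup_v E v) = (\sum_v P (E v))%E.
Proof.
move=> mE tE; rewrite measure_fin_bigcup //; last exact: finite_finset.
rewrite (_ : setT = [set` index_enum V]).
  by rewrite -fsbig_seq ?index_enum_uniq.
by apply/seteqP; split=> v //= _; rewrite mem_index_enum.
Qed.

(** * Decoding success in terms of coefficients and deletions *)

Section Butterfly.
Context {F : finFieldType}.

(** Rows stand for the imaginary source channels and columns for [e1], [e2], so that [source_mx] is
    the matrix (f_1 f_2). *)
Definition source_coef (i j : 'I_2) : coef :=
  if j == 0 then (if i == 0 then k_d1_1 else k_d2_1)
  else (if i == 0 then k_d1_2 else k_d2_2).

Definition source_mx (k : coef -> F) : 'M[F]_2 :=
  \matrix_(i, j) k (source_coef i j).

(** The coefficients met beyond [s] on two edge-disjoint paths from [s] to the sink; [sink_channels]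
    collects the channels of these paths. *)
Definition sink_coefs (t : sink) : seq coef :=
  match t with
  | t1 => [:: k_1_3; k_2_5; k_5_7; k_7_8]
  | t2 => [:: k_2_6; k_1_4; k_4_7; k_7_9]
  end.

Definition sink_channels (t : sink) : seq channel :=
  match t with
  | t1 => [:: e1; e2; e3; e5; e7; e8]
  | t2 => [:: e1; e2; e4; e6; e7; e9]
  end.

(** The first column is a multiple of f_1 at [t1] and of f_2 at [t2], so the component of the second
    column in that direction drops out. At [t2] the roles of f_1 and f_2 are swapped, whence the
    sign. *)
Lemma det_decoding_matrix (k : coef -> F) (del : channel -> bool) (t : sink) :
  \det (decoding_matrix k del t) =
  (if t is t1 then 1 else -1) * \det (source_mx k)
    * (\prod_(c <- sink_coefs t) k c)
    * \prod_(m <- sink_channels t) (~~ del m)%:R.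
Proof.
(* Deletion becomes a scalar factor, which leaves a polynomial identity for [ring]. *)
have act b (f : 'cV[F]_2) : (if b then 0 else f) = (~~ b)%:R *: f.
  by case: b; rewrite ?scale0r ?scale1r.
have split0 : fintype.split (0 : 'I_(1 + 1)) = inl 0.
  by case: splitP => j //= _; rewrite ord1.
have split1 : fintype.split (1 : 'I_(1 + 1)) = inr 0.
  by case: splitP => j //= ; rewrite ord1.
rewrite !det_mx2 /decoding_matrix /active_kernel.
case: t; rewrite /encoding_kernel !act !mxE split0 split1 !mxE /=
  !big_cons !big_nil; ring.
Qed.

(** Arbitrary lists [s] and [u] let one probability computation serve each sink and the whole
    network. *)
Definition good_event {T : Type} (k : coef -> T -> F)
    (del : channel -> T -> bool) (s : seq coef) (u : seq channel) : set T :=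
  [set w | [&& source_mx (k^~ w) \in unitmx, all (fun c => k c w != 0) s
           & all (fun m => ~~ del m w) u]].

Lemma sink_failureE {T : Type} (k : coef -> T -> F)
    (del : channel -> T -> bool) (t : sink) :
  sink_failure k del t =
  ~` good_event k del (sink_coefs t) (sink_channels t).
Proof.
rewrite -[LHS]setCK; congr (~` _); apply: funext => w; apply: propext.
rewrite /sink_failure /good_event /setC /mkset /= rank_lt_det.
apply: (iff_trans (rwP negP)); rewrite det_decoding_matrix !mulf_eq0 !negb_or.
have -> : (if t is t1 then 1 else -1 : F) != 0.
  by case: t; rewrite ?oppr_eq0 oner_eq0.
have natb_neq0 (b : bool) : ((b%:R : F) != 0) = b.
  by case: b; rewrite ?oner_eq0 ?eqxx.
rewrite !prodf_seq_neq0 unitmxE unitfE /= -andbA.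
by under [X in [&& _, _ & X]]eq_all do rewrite natb_neq0.
Qed.

Lemma network_failureE {T : Type} (k : coef -> T -> F)
    (del : channel -> T -> bool) :
  [set w | exists t : sink, sink_failure k del t w] =
  ~` good_event k del (sink_coefs t1 ++ sink_coefs t2) channel_enum.
Proof.
have -> : good_event k del (sink_coefs t1 ++ sink_coefs t2) channel_enum =
    good_event k del (sink_coefs t1) (sink_channels t1)
    `&` good_event k del (sink_coefs t2) (sink_channels t2).
  apply: funext => w; apply: propext; rewrite /good_event /setI /mkset.
  apply: (iff_trans _ (iff_sym (rwP andP))).
  (* Only membership matters for [all], so [e1], [e2], [e7], shared by both sinks, need be listed
     only once. *)
  rewrite all_cat (eq_all_r (s2 := sink_channels t1 ++ sink_channels t2)).
    by rewrite all_cat; case: (_ \in _); rewrite //= andbACA.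
  by case.
rewrite setCI -!sink_failureE; apply/seteqP; split=> w /=.
  by case=> -[]; [left|right].
by case; [exists t1|exists t2].
Qed.

End Butterfly.

(** * Probability of decoding success *)

Section Probability.
Context {R : realType} {F : finFieldType} {p : R}.
Context {d : measure_display} {T : measurableType d} {P : probability T R}.
Context {k : coef -> T -> F} {del : channel -> T -> bool}.
Context (hG : butterfly_rlnc P p k del).

Let q : R := #|F|%:R.

Lemma coef_preimageE c (B : {pred F}) :
  [set w | k c w \in B] = \bigcup_(a : {a | a \in B}) (k c @^-1` [set val a]).
Proof.
apply/seteqP; split=> w /=.
  by move=> Bw; exists (exist (fun a => a \in B) _ Bw).
by case=> -[a Ba] _ /= ->.
Qed.

Lemma measurable_coef c (B : {pred F}) : measurable [set w | k c w \in B].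
Proof.
rewrite coef_preimageE; apply: fin_bigcup_measurable => [|a _].
  exact: finite_finset.
exact: (coef_rv hG).
Qed.

Lemma probability_coef c (B : {pred F}) :
  P [set w | k c w \in B] = (#|B|%:R / q)%:E.
Proof.
rewrite coef_preimageE probability_finite_union.
- under eq_bigr do rewrite (coef_uniform hG).
  by rewrite sumEFin sumr_const card_sig mulr_natl.
- by move=> a; apply: (coef_rv hG).
- by move=> a b _ _ [w [/= -> /val_inj]].
Qed.

Lemma measurable_no_del m : measurable [set w | ~~ del m w].
Proof.
have := del_rv hG m false; congr (measurable _).
by apply/seteqP; split=> w /=; case: (del m w).
Qed.

Lemma probability_no_del m : P [set w | ~~ del m w] = (1 - p)%:E.
Proof.
have -> : [set w | ~~ del m w] = ~` [set w | del m w].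
  by apply/seteqP; split=> w /= /negP.
rewrite probability_setC ?(del_prob hG)//.
exact: del_rv hG m true.
Qed.

(** Each condition involves a single random variable, so independence gives the probability as a
    product. *)
Definition box (B : coef -> {pred F}) (s : seq coef) (u : seq channel) : set T :=
  [set w | all (fun c => k c w \in B c) s && all (fun m => ~~ del m w) u].

Definition box_side (B : coef -> {pred F}) (x : coef + channel) : set T :=
  match x with
  | inl c => [set w | k c w \in B c]
  | inr m => [set w | ~~ del m w]
  end.

Lemma boxE (B : coef -> {pred F}) s u :
  box B s u =
  \bigcap_(x in [set` [set x in map inl s ++ map inr u]%SET]) box_side B x.
Proof.
apply/seteqP; split=> w /=.
  move=> /andP[/allP Bs /allP du] x /=; rewrite finset.in_set mem_cat => /orP[] /mapP[y ys ->].
    exact: Bs.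
  exact: du.
move=> H; apply/andP; split; apply/allP => y ys.
  by apply: (H (inl y)); rewrite /= finset.in_set mem_cat map_f.
by apply: (H (inr y)); rewrite /= finset.in_set mem_cat map_f ?orbT.
Qed.

Lemma measurable_box (B : coef -> {pred F}) s u : measurable (box B s u).
Proof.
rewrite boxE; apply: fin_bigcap_measurable => [|[c|m] _].
- exact: finite_finset.
- exact: measurable_coef.
- exact: measurable_no_del.
Qed.

Lemma probability_box (B : coef -> {pred F}) s u : uniq s -> uniq u ->
  P (box B s u) = ((\prod_(c <- s) (#|B c|%:R / q)) * (1 - p) ^+ size u)%:E.
Proof.
move=> us uu; rewrite boxE (coef_del_independent hG); last first.
  case=> [c|m] _.
    by exists [set a | a \in B c].
  by exists [set b | ~~ b].
(* The concatenated list has no repetition, since [inl] and [inr] have disjoint images; the product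
   over the set is thus one over the list. *)
rewrite (eq_bigl _ _ (finset.in_set _)) -big_uniq /=; last first.
  rewrite cat_uniq !map_inj_uniq ?us ?uu ?andbT /=; try by move=> ? ? [].
  by apply/hasPn => x /mapP[m _ ->]; apply/mapP => -[].
rewrite big_cat !big_map /=.
under eq_bigr do rewrite probability_coef.
rewrite prodEFin; under [X in (_ * X)%E]eq_bigr do rewrite probability_no_del.
by rewrite prodEFin big_const_seq count_predT iter_mulr_1.
Qed.

Definition source_coefs : seq coef := [:: k_d1_1; k_d2_1; k_d1_2; k_d2_2].

(** Invertibility ties the four source coefficients together; prescribing the matrix [g] separates
    it into one condition per coefficient. *)
Definition good_box (g : {'GL_2[F]}) (c : coef) : {pred F} :=
  match c with
  | k_d1_1 => pred1 (GLval g 0 0)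
  | k_d2_1 => pred1 (GLval g 1 0)
  | k_d1_2 => pred1 (GLval g 0 1)
  | k_d2_2 => pred1 (GLval g 1 1)
  | _ => predC1 0
  end.

(** An outcome determines [g], which makes the boxes of distinct matrices disjoint. *)
Lemma box_source_mx g s u w :
  box (good_box g) (source_coefs ++ s) u w -> source_mx (k^~ w) = GLval g.
Proof.
rewrite /box /= !inE => /andP[/and5P[/eqP h00 /eqP h10 /eqP h01 /eqP h11 _] _].
apply/matrixP => i j; rewrite mxE /source_coef.
case: (unliftP 0 i) => [i'|] ->; case: (unliftP 0 j) => [j'|] -> //=;
  rewrite ?ord1.
- by rewrite h11; congr (GLval g _ _); apply/val_inj.
- by rewrite h10; congr (GLval g _ _); apply/val_inj.
- by rewrite h01; congr (GLval g _ _); apply/val_inj.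
Qed.

Arguments box_source_mx {g s u w}.

Lemma good_eventE s u : uniq (source_coefs ++ s) ->
  good_event k del s u =
  \bigcup_g box (good_box g) (source_coefs ++ s) u.
Proof.
rewrite cat_uniq => /and3P[_ /hasPn sdisj _].
(* Members of [s] are not source coefficients, hence fall under the default case. *)
have good_nz g c : c \in s -> good_box g c = predC1 0.
  by move=> /sdisj; case: c.
apply/seteqP; split=> w.
  rewrite /good_event /= => /and3P[ug /allP sw uw].
  exists (FinRing.unit _ ug : {'GL_2[F]}) => //.
  rewrite /box /= uw !inE /= !mxE /source_coef /= !eqxx /= andbT.
  by apply/allP => c cs; rewrite good_nz // inE; exact: sw.
case=> g _ gw; rewrite /good_event /= (box_source_mx gw) (GL_unitmx g) /=.
move: gw; rewrite /box /= => /andP[/and5P[_ _ _ _ /allP sw] ->].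
by rewrite andbT; apply/allP => c cs; have := sw c cs; rewrite good_nz.
Qed.

Lemma measurable_good_event s u : uniq (source_coefs ++ s) ->
  measurable (good_event k del s u).
Proof.
move=> us; rewrite good_eventE //; apply: fin_bigcup_measurable => [|g _].
  exact: finite_finset.
exact: measurable_box.
Qed.

(** A uniform 2 x 2 matrix is invertible with probability |GL_2(F)| / q^4 = (q + 1)(q - 1)^2 / q^3,
    which explains the offsets 2 and 3 in the exponents. *)
Lemma probability_good_event s u : uniq (source_coefs ++ s) -> uniq u ->
  P (good_event k del s u) =
  ((q + 1) * (q - 1) ^+ (size s).+2 / q ^+ (size s + 3)
   * (1 - p) ^+ size u)%:E.
Proof.
move=> us uu; have q_neq0 : q != 0.
  by rewrite pnatr_eq0 -lt0n; apply/card_gt0P; exists 0.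
have qP : #|F|.-1%:R = q - 1 :> R.
  by rewrite -subn1 natrB //; apply/card_gt0P; exists 0.
rewrite good_eventE // probability_finite_union; last 2 first.
- by move=> g; apply: measurable_box.
- move=> g h _ _ [w [gw hw]]; apply/val_inj.
  exact: etrans (esym (box_source_mx gw)) (box_source_mx hw).
(* Every [g] contributes equally: 1/q per source coefficient, (q - 1)/q per coefficient of [s]. *)
have -> : \sum_g P (box (good_box g) (source_coefs ++ s) u) =
   (\sum_(g : {'GL_2[F]}) ((q^-1 ^+ 4 * ((q - 1) / q) ^+ size s)
                    * (1 - p) ^+ size u)%:E)%E.
  apply: eq_bigr => g _; rewrite probability_box //; congr (_ * _)%:E.
  rewrite !big_cons !card1 !mul1r.
  rewrite (eq_big_seq (fun=> (q - 1) / q)); last first.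
    move: us; rewrite cat_uniq => /and3P[_ /hasPn sdisj _].
    by move=> c /sdisj; rewrite -qP -(cardC1 (0 : F)); case: c.
  by rewrite big_const_seq count_predT iter_mulr_1 !exprS expr0 mulr1 !mulrA.
rewrite sumEFin sumr_const; congr (_%:E).
have -> : #|{: {'GL_2[F]}}| = (#|F| * #|F|.-1 ^ 2 * #|F|.+1)%N.
  by rewrite -card_GL_2 cardsT.
rewrite -[LHS]mulr_natl !natrM -!natr1 !qP -/q.
by rewrite expr_div_n exprD !exprS expr0; field; rewrite q_neq0 expf_neq0.
Qed.

End Probability.

Theorem theorem2 (R : realType) (F : finFieldType) (p : R) (hp : 0 <= p <= 1)
    (d : measure_display) (T : measurableType d) (P : probability T R)
    (k : coef -> T -> F) (del : channel -> T -> bool)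
    (hG : butterfly_rlnc P p k del) :
  (forall t : sink,
     sink_failure_prob P k del t =
     (1 - (#|F|%:R + 1) * (#|F|%:R - 1) ^+ 6 / #|F|%:R ^+ 7
          * (1 - p) ^+ 6)%:E) /\
  network_failure_prob P k del =
    (1 - (#|F|%:R + 1) * (#|F|%:R - 1) ^+ 10 / #|F|%:R ^+ 11
         * (1 - p) ^+ 9)%:E /\
  average_failure_prob P k del =
    (1 - (#|F|%:R + 1) * (#|F|%:R - 1) ^+ 6 / #|F|%:R ^+ 7
         * (1 - p) ^+ 6)%:E.
Proof.
have sinkP t : sink_failure_prob P k del t =
    (1 - (#|F|%:R + 1) * (#|F|%:R - 1) ^+ 6 / #|F|%:R ^+ 7
         * (1 - p) ^+ 6)%:E.
  rewrite /sink_failure_prob sink_failureE probability_setC; last first.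
    by apply: (measurable_good_event hG); case: t.
  (* Four coefficients and six channels at either sink. *)
  by rewrite (probability_good_event hG); case: t.
split; [exact: sinkP|split].
  rewrite /network_failure_prob network_failureE probability_setC; last first.
    exact: (measurable_good_event hG).
  (* Eight coefficients and nine channels for both sinks together. *)
  by rewrite (probability_good_event hG).
rewrite /average_failure_prob (eq_bigr _ (fun t _ => sinkP t)).
rewrite sumEFin sumr_const -EFinM -[X in _^-1 * X]mulr_natl mulKf //.
by rewrite pnatr_eq0 -lt0n; apply/card_gt0P; exists t1.
Qed.
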